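(* Let $f:\mathbb{R}^n\to\mathbb{R}$ be convex and continuously differentiable with $L_1$-Lipschitz gradient, i.e. $\|\nabla f(x)-\nabla f(y)\|\le L_1\|x-y\|$ for all $x,y$. Let the noisy objective be $\tilde f(x;\xi)=f(x)+\nu(x;\xi)$, where for all $x\in\mathbb{R}^n$ the noise $\nu(x;\xi)$ is i.i.d. with $\mathbb{E}_\xi[\nu(x;\xi)]=0$ and variance $\sigma_a^2=\mathrm{Var}(\nu(x;\xi))>0$ (independent of $x$). Let $u\in\mathbb{R}^n$ be a standard Gaussian vector (mean $0$, covariance $I_n$), and let $u,\xi_1,\xi_2$ be independent. For $\mu>0$ define $$\mathcal{E}(\mu)=\left\|\frac{\tilde f(x+\mu u;\xi_1)-\tilde f(x;\xi_2)}{\mu}u-\langle\nabla f(x),u\rangle u\right\|^2 .$$ If $$\mu^*=\left[\frac{8\sigma_a^2 n}{L_1^2(n+6)^3}\right]^{1/4},$$ then for every $x\in\mathbb{R}^n$, $$\mathbb{E}_{u,\xi_1,\xi_2}[\mathcal{E}(\mu^* )]\le \sqrt{2}\,L_1\sigma_a\sqrt{n(n+6)^3}.$$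
   Context: $\|\cdot\|$ is the Euclidean norm and $\langle\cdot,\cdot\rangle$ the Euclidean inner product. The noise values $\nu(\cdot;\xi_1)$ and $\nu(\cdot;\xi_2)$ entering the two evaluations are independent, each with mean $0$ and variance $\sigma_a^2$. *)

(* Defs.v *)
From HB Require Import structures.
From mathcomp Require Import all_boot all_order all_algebra.
From mathcomp Require Import all_classical all_reals all_analysis.
Set Implicit Arguments. Unset Strict Implicit. Unset Printing Implicit Defensive.
Import Order.TTheory GRing.Theory Num.Theory.
Import numFieldNormedType.Exports.
Local Open Scope classical_set_scope.
Local Open Scope ring_scope.

Definition dotv {R : realType} {n : nat} (u v : 'rV[R]_n) : R :=
  \sum_(i < n) u ord0 i * v ord0 i.
Definition enorm {R : realType} {n : nat} (v : 'rV[R]_n) : R :=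
  Num.sqrt (dotv v v).

Definition grad {R : realType} {n : nat} (f : 'rV[R]_n -> R) (x : 'rV[R]_n)
  : 'rV[R]_n := \row_(i < n) ('d f x (delta_mx ord0 i : 'rV[R]_n)).

Definition convex_fun {R : realType} {n : nat} (f : 'rV[R]_n -> R) : Prop :=
  forall (x y : 'rV[R]_n) (a : R), 0 <= a <= 1 ->
    f (a *: x + (1 - a) *: y) <= a * f x + (1 - a) * f y.

(* Identify an n-tuple (carrying the product sigma-algebra) with a row vector. *)
Definition rv_of_tuple {R : realType} {n : nat} (t : n.-tuple R) : 'rV[R]_n :=
  \row_(i < n) tnth t i.

(* Mutual independence of the family (U_1, ..., U_n, Xi1, Xi2) of random
   elements: product rule for preimages of measurable sets (taking some of
   the sets to be the whole space yields the product rule for every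
   subfamily). *)
Definition mutually_indep {d dX : measure_display} {T : measurableType d}
  {X : measurableType dX} {R : realType} (P : probability T R) {n : nat}
  (U : 'I_n -> T -> R) (Xi1 Xi2 : T -> X) : Prop :=
  forall (B : 'I_n -> set R) (C1 C2 : set X),
    (forall i, measurable (B i)) -> measurable C1 -> measurable C2 ->
    P ((\bigcap_(i in [set: 'I_n]) (U i @^-1` B i))
         `&` (Xi1 @^-1` C1) `&` (Xi2 @^-1` C2)) =
    ((\prod_(i < n) P (U i @^-1` B i)) * P (Xi1 @^-1` C1) * P (Xi2 @^-1` C2))%E.

Definition err_quantity {d dX : measure_display} {T : measurableType d}
  {X : measurableType dX} {R : realType} {n : nat}
  (f : 'rV[R]_n -> R) (nu : 'rV[R]_n -> X -> R)
  (U : T -> 'rV[R]_n) (Xi1 Xi2 : T -> X) (x : 'rV[R]_n) (mu : R) (w : T) : R :=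
  let ft := fun (y : 'rV[R]_n) (xi : X) => f y + nu y xi in
  enorm (((ft (x + mu *: U w) (Xi1 w) - ft x (Xi2 w)) / mu) *: U w
         - dotv (grad f x) (U w) *: U w) ^+ 2.

(* Main.v *)
(** Subtracting [<grad f x, u> u] leaves [((D + nu1 - nu2) / mu) u], where
    [D] is the first-order Taylor remainder of [f] at [x] along [mu u], so
    [|D| <= L1 mu^2 |u|^2 / 2]. Conditionally on [u] the two noise terms are
    centered and independent, hence by Tonelli the mean error is
    [E (|u|^2 (D^2 + 2 sigma_a^2)) / mu^2], which is at most
    [L1^2 mu^2 / 4 * E |u|^6 + 2 sigma_a^2 / mu^2 * E |u|^2]. Since
    [E |u|^6 <= n (n + 2) (n + 4) <= (n + 6)^3], the choice of [mu] that
    balances the two terms gives the bound. *)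

Require Import Defs.
From HB Require Import structures.
From mathcomp Require Import all_boot all_order all_algebra.
From mathcomp Require Import all_classical all_reals all_analysis.
From mathcomp Require Import measurable_realfun ring lra.
Import Order.TTheory GRing.Theory Num.Theory.
Import numFieldNormedType.Exports.
Local Open Scope classical_set_scope.
Local Open Scope ring_scope.

(** * Euclidean geometry and the Taylor remainder *)

(** The constant in [mu_star] is tuned to the relaxed sixth moment [(n + 6) ^ 3], not to the sharp
    one: with the relaxed value the two error terms coincide, and each is half of the final bound.
    The main obstacle is measure-theoretic. Independence is given as a product rule on preimages of
    boxes, while conditioning on [u] needs it for arbitrary measurable sets of tuples and of noise
    pairs; a Dynkin-class argument, applied to one component at a time, bridges this gap. What is
    integrated over [u] is nonnegative, so upper bounds in the extended reals suffice and finiteness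
    of the Gaussian moments is never a separate question. *)

Lemma first_order_remainder {R : realType} (g dg : R -> R) (c M : R) :
  (forall t : R, is_derive t 1 g (dg t)) ->
  (forall t, 0 <= t -> `|dg t - c| <= M * t) ->
  `|g 1 - g 0 - c| <= M / 2.
Proof.
move=> gd gM.
(* The sign [s] treats both halves of the absolute value at once. *)
suff key (s : R) : `|s| = 1 -> s * (g 1 - g 0 - c) <= M / 2.
  rewrite ler_norml lerNl -mulN1r key ?normrN1//=.
  by rewrite -[leLHS]mul1r key ?normr1.
move=> s1.
(* The quadratic term absorbs the growth of [dg - c], so [dh <= 0] on [[0, 1]] and the mean value
   theorem gives [h 1 <= h 0] without integrating [dg]. *)
pose h t := s * (g t - c * t) - M / 2 * t ^+ 2.
pose dh t := s * (dg t - c) - M * t.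
have hd (t : R) : is_derive t 1 h (dh t).
  have D1 : is_derive t 1 (g - c \*: id) (dg t - c *: 1).
    by apply: is_deriveB; apply: is_deriveZ; exact: is_derive_id.
  have D2 : is_derive t 1 (id ^+ 2 : R -> R) ((2%:R * t ^+ 1) *: (1 : R)).
    exact: is_deriveX.
  have -> : h = s \*: (g - c \*: id) - (M / 2) \*: (id ^+ 2 : R -> R).
    by apply/funext => r.
  have := is_deriveB (is_deriveZ s D1) (is_deriveZ (M / 2) D2).
  move=> /is_derive_eq; apply; rewrite /dh /GRing.scale/= expr1; by field.
have hc : {within `[0, 1], continuous h}.
  apply: continuous_subspaceT => r; apply: differentiable_continuous.
  have [dr _] := hd r.
  by apply/derivable1_diffP.
have [z z01] := @MVT_segment _ h dh 0 1 ler01 (fun t _ => hd t) hc.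
rewrite subr0 mulr1 => hE.
have : dh z <= 0.
  rewrite /dh subr_le0; apply: le_trans (ler_norm _) _.
  by rewrite normrM s1 mul1r gM// (itvP z01).
by rewrite -hE /h !mulr0 expr0n/= expr1n !mulr1 mulr0; lra.
Qed.

Section Descent.
Context {R : realType} {n : nat}.
Implicit Types u v x y : 'rV[R]_n.

Lemma dotv_ge0 v : 0 <= dotv v v.
Proof. by apply: sumr_ge0 => i _; rewrite -expr2 sqr_ge0. Qed.

Lemma enorm_ge0 v : 0 <= enorm v.
Proof. exact: sqrtr_ge0. Qed.

Lemma sqr_enorm v : enorm v ^+ 2 = dotv v v.
Proof. by rewrite sqr_sqrtr// dotv_ge0. Qed.

Lemma dotvZ (a b : R) u v : dotv (a *: u) (b *: v) = a * b * dotv u v.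
Proof.
rewrite /dotv mulr_sumr; apply: eq_bigr => i _; rewrite !mxE; ring.
Qed.

Lemma dotvZr (a : R) u v : dotv u (a *: v) = a * dotv u v.
Proof. by rewrite -[in LHS](scale1r u) dotvZ mul1r. Qed.

Lemma dotvBl u v w : dotv (u - v) w = dotv u w - dotv v w.
Proof.
by rewrite /dotv -sumrB; apply: eq_bigr => i _; rewrite !mxE mulrBl.
Qed.

Lemma dotvC u v : dotv u v = dotv v u.
Proof. by apply: eq_bigr => i _; rewrite mulrC. Qed.

Lemma dotvBr u v w : dotv u (v - w) = dotv u v - dotv u w.
Proof. by rewrite ![dotv u _]dotvC dotvBl. Qed.

Lemma enormZ (a : R) v : enorm (a *: v) = `|a| * enorm v.
Proof. by rewrite /enorm dotvZ sqrtrM -?expr2 ?sqr_ge0// sqrtr_sqr. Qed.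

(** Cauchy-Schwarz; it turns the Lipschitz bound on the gradient into a bound on directional
    derivatives. *)
Lemma dotv_le u v : `|dotv u v| <= enorm u * enorm v.
Proof.
rewrite -ler_sqr ?nnegrE ?mulr_ge0 ?enorm_ge0//.
rewrite real_normK ?num_real// exprMn !sqr_enorm.
have [v0|v0] := eqVneq (dotv v v) 0.
  have vi i : v ord0 i = 0.
    move/eqP: v0; rewrite psumr_eq0 => [/allP/(_ i)|j _].
      by rewrite mem_index_enum mulf_eq0 orbb => /(_ isT)/eqP.
    by rewrite -expr2 sqr_ge0.
  rewrite v0 mulr0 /dotv big1 ?expr0n// => i _; by rewrite vi mulr0.
have v1 : 0 < dotv v v by rewrite lt_def v0 dotv_ge0.
(* Up to the factor [dotv v v], this is [u] minus its projection on [v]; its squared norm is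
   [dotv v v] times the Cauchy-Schwarz gap. *)
have := dotv_ge0 (dotv v v *: u - dotv u v *: v).
rewrite !(dotvBl, dotvBr) !dotvZ (dotvC v u).
set a := dotv v v; set b := dotv u v; set c := dotv u u.
have -> : a * a * c - a * b * b - (b * a * b - b * b * a) = a * (c * a - b ^+ 2) by ring.
by rewrite pmulr_rge0// subr_ge0.
Qed.

Lemma diff_grad (f : 'rV[R]_n -> R) x v : differentiable f x ->
  'd f x v = dotv (grad f x) v.
Proof.
move=> df; rewrite [in LHS](row_sum_delta v) linear_sum; apply: eq_bigr => i _.
by rewrite linearZ/= mxE mulrC.
Qed.

Lemma is_derive_line (f : 'rV[R]_n -> R) x v (t : R) :
  (forall y, differentiable f y) ->
  is_derive t 1 (fun s : R => f (x + s *: v)) (dotv (grad f (x + t *: v)) v).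
Proof.
move=> df.
have dg : is_diff t (fun s : R => x + s *: v) (fun s => s *: v).
  have -> : (fun s : R => x + s *: v) = cst x + ( *:%R^~ v : R -> 'rV[R]_n) by [].
  rewrite -[X in is_diff _ _ X]add0r; exact: is_diffD.
have dfx := df (x + t *: v).
have dc : differentiable (f \o (fun s : R => x + s *: v)) t.
  exact: differentiable_comp.
apply: DeriveDef; first exact/diff_derivable.
rewrite deriveE// diff_comp//= -diff_grad//.
by rewrite (@diff_val _ _ _ _ _ _ _ dg) scale1r.
Qed.

(** Restrict [f] to the segment from [x] to [x + v]: the slope at time [t] differs from the initial
    slope by at most [L * enorm v ^+ 2 * t]. *)
Lemma descent (f : 'rV[R]_n -> R) (L : R) x v :
  (forall y, differentiable f y) ->
  (forall y z, enorm (grad f y - grad f z) <= L * enorm (y - z)) ->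
  `|f (x + v) - f x - dotv (grad f x) v| <= L * enorm v ^+ 2 / 2.
Proof.
move=> df Lf.
have := @first_order_remainder _ _ _ (dotv (grad f x) v) (L * enorm v ^+ 2)
  (fun t => is_derive_line f x v t df).
rewrite scale1r scale0r addr0; apply => t t0.
rewrite -dotvBl; apply: le_trans (dotv_le _ _) _.
apply: le_trans (ler_wpM2r (enorm_ge0 _) (Lf _ _)) _.
rewrite addrAC subrr add0r enormZ ger0_norm//.
by move: (enorm v) => e; rewrite le_eqVlt; apply/orP; left; apply/eqP; ring.
Qed.
End Descent.

(** * Measurability and independence *)

Section ContinuousMeasurable.
Context {R : realType} {d : measure_display} {T : measurableType d} {n : nat}.

Lemma measurable_fun_discrete {I : countType} (g : T -> I) (h : I -> R) :
  (forall i, measurable (g @^-1` [set i])) ->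
  measurable_fun setT (fun w => h (g w)).
Proof.
move=> mg _ B _; rewrite setTI.
have -> : (fun w => h (g w)) @^-1` B =
    \bigcup_(i in h @^-1` B) (g @^-1` [set i]).
  apply/seteqP; split=> [w Bw|w [i hi /= ->]//].
  by exists (g w).
rewrite bigcup_mkcond; apply: countable_bigcupT_measurable => // i.
by case: ifP.
Qed.

(* [f \o V] is the pointwise limit of [f] composed with [V] rounded down to the
   grid of step [1 / (k + 1)], and the rounded map takes countably many values. *)
Lemma measurable_continuous_rV (f : 'rV[R]_n -> R) (V : T -> 'rV[R]_n) :
  continuous f -> (forall i, measurable_fun setT (fun w => V w ord0 i)) ->
  measurable_fun setT (fun w => f (V w)).
Proof.
move=> cf mV.
pose g k (w : T) : {ffun 'I_n -> int} := [ffun i => Num.floor (k.+1%:R * V w ord0 i)].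
pose r k (c : {ffun 'I_n -> int}) : 'rV[R]_n := \row_i ((c i)%:~R / k.+1%:R).
apply: (@measurable_fun_cvg _ _ _ _ (fun k w => f (r k (g k w)))).
  move=> k; apply: (@measurable_fun_discrete _ (g k) (fun c => f (r k c))) => c.
  have -> : g k @^-1` [set c] = \bigcap_(i in [set: 'I_n])
      ((fun w => Num.floor (k.+1%:R * V w ord0 i)) @^-1` [set c i]).
    apply/seteqP; split=> [w <- i _|w cw]; first by rewrite /g /= ffunE.
    by apply/ffunP => i; rewrite ffunE; exact: cw.
  apply: fin_bigcap_measurable => // i _.
  have -> : (fun w => Num.floor (k.+1%:R * V w ord0 i)) @^-1` [set c i] =
      setT `&` (fun w => k.+1%:R * V w ord0 i) @^-1` `[(c i)%:~R, (c i + 1)%:~R[%classic.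
    rewrite setTI; apply/seteqP; split=> w /=; rewrite in_itv/=.
      by move=> <-; exact: floor_itv.
    exact: floor_def.
  exact: (measurable_funM (measurable_cst _) (mV i)).
move=> w _; apply: continuous_cvg; first exact: cf.
apply/cvg_ballP => e e0; near=> k; split=> // a i; rewrite (ord1 a) /ball/= !mxE ffunE.
have k0 : (0 : R) < k.+1%:R by rewrite ltr0n.
have /andP[lo hi] := floor_itv (k.+1%:R * V w ord0 i).
rewrite ltr_norml; apply/andP; split.
  apply: lt_le_trans (_ : 0 <= _); first by rewrite oppr_lt0.
  by rewrite subr_ge0 ler_pdivrMr// [leRHS]mulrC.
apply: (@le_lt_trans _ _ k.+1%:R^-1).
  rewrite lerBlDr -{1}[k.+1%:R^-1]mul1r -mulrDl ler_pdivlMr// mulrC addrC.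
  by rewrite (le_trans (ltW hi))// intrD.
near: k; exact: near_infty_natSinv_lt (PosNum e0).
Unshelve. all: by end_near. Qed.
End ContinuousMeasurable.

(** * Product laws and extension of independence from generators *)

Section Tonelli.
Context {R : realType} {d d1 d2 : measure_display} {T : measurableType d}
  {A : measurableType d1} {B : measurableType d2} (P : probability T R)
  (V : T -> A) (W : T -> B).
Hypotheses (mV : measurable_fun setT V) (mW : measurable_fun setT W).
Hypothesis indepVW : forall C D, measurable C -> measurable D ->
  P (V @^-1` C `&` W @^-1` D) = (P (V @^-1` C) * P (W @^-1` D))%E.

(** The law of [(V, W)] agrees with the product of the two laws on rectangles, hence everywhere, and
    Tonelli applies. Both integrals are pulled back to [P], so the result reads as replacing [W] by
    an independent copy. *)
Lemma ge0_integral_indep (h : A * B -> \bar R) :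
  measurable_fun setT h -> (forall z, 0 <= h z)%E ->
  (\int[P]_w h (V w, W w) = \int[P]_w \int[P]_w' h (V w, W w'))%E.
Proof.
move=> mh h0.
pose rV : {RV P >-> A} := HB.pack V (isMeasurableFun.Build _ _ _ _ _ mV).
pose rW : {RV P >-> B} := HB.pack W (isMeasurableFun.Build _ _ _ _ _ mW).
have mVW : measurable_fun setT (fun w => (V w, W w)) by exact: measurable_fun_pair.
pose rVW : {RV P >-> (A * B)%type} :=
  HB.pack (fun w => (V w, W w)) (isMeasurableFun.Build _ _ _ _ _ mVW).
rewrite -[LHS](@ge0_integral_distribution _ _ _ _ _ _ rVW h)//.
transitivity (\int[distribution P rV \x distribution P rW]_z h z)%E.
  apply: eq_measure_integral => C mC _; apply/esym.
  exact: product_measure_unique.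
rewrite fubini_tonelli1// (@ge0_integral_distribution _ _ _ _ _ _ rV)//; last 2 first.
- exact: measurable_fun_fubini_tonelli_F.
- by move=> x; apply: integral_ge0 => y _.
apply: eq_integral => w _.
rewrite /fubini_F /= (@ge0_integral_distribution _ _ _ _ _ _ rW (fun y => h (V w, y)))//.
exact: measurableT_comp.
Qed.

Lemma ge0_integralM_indep (g : A -> R) (k : B -> R) :
  measurable_fun setT g -> measurable_fun setT k ->
  (forall x, 0 <= g x) -> (forall x, 0 <= k x) ->
  (\int[P]_w (g (V w) * k (W w))%:E =
   \int[P]_w (g (V w))%:E * \int[P]_w (k (W w))%:E)%E.
Proof.
move=> mg mk g0 k0.
have mkW : measurable_fun setT (fun w => (k (W w))%:E).
  by apply/measurable_EFinP; exact: measurableT_comp.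
rewrite (ge0_integral_indep (fun z => (g z.1 * k z.2)%:E)); last 2 first.
- apply/measurable_EFinP; apply: measurable_funM.
    exact: (measurableT_comp mg measurable_fst).
  exact: (measurableT_comp mk measurable_snd).
- by move=> z; rewrite lee_fin mulr_ge0.
transitivity (\int[P]_w ((g (V w))%:E * \int[P]_w' (k (W w'))%:E))%E.
  apply: eq_integral => w _ /=; under eq_integral do rewrite EFinM.
  rewrite ge0_integralZl ?lee_fin// => w' _; exact: k0.
rewrite ge0_integralZr//.
- by apply/measurable_EFinP; exact: measurableT_comp.
- by move=> w _; exact: g0.
- by apply: integral_ge0 => w _; rewrite lee_fin.
Qed.
End Tonelli.

(** For a fixed event [E], the sets obeying the product rule form a Dynkin class; if it contains a
    generating pi-system, it contains every measurable set. *)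
Lemma indep_generated {R : realType} {d dA : measure_display}
    {T : measurableType d} {A : measurableType dA} (P : probability T R)
    (G : set (set A)) (V : T -> A) (E : set T) :
  @measurable _ A = <<s G >> -> setI_closed G ->
  measurable_fun setT V -> measurable E ->
  (forall S, G S -> P (V @^-1` S `&` E) = (P (V @^-1` S) * P E)%E) ->
  forall S, measurable S -> P (V @^-1` S `&` E) = (P (V @^-1` S) * P E)%E.
Proof.
move=> GE GI mV mE PG S.
have mVA B : measurable B -> measurable (V @^-1` B).
  by move=> mB; rewrite -[X in measurable X]setTI; exact: mV.
rewrite GE; move: S; apply: (dynkin_induction GE GI).
- by rewrite preimage_setT setTI probability_setT mul1e.
- exact: PG.
- move=> S mS; rewrite -[V @^-1` ~` S]/(~` (V @^-1` S)).
  move: (V @^-1` S) (mVA _ mS) => B mB IH.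
  (* The complement case is [P E - P B * P E = (1 - P B) * P E], legitimate because these values are
     finite. *)
  rewrite setIC -setDE measureD//; last by rewrite ltey_eq fin_num_measure.
  rewrite (setIC _ B) [X in (_ - X)%E]IH probability_setC//.
  rewrite -[X in (X - _)%E](mul1e (P E)) -muleBl//; exact: fin_num_measure.
- move=> F mF tF IH; rewrite preimage_bigcup setI_bigcupl.
  have tVF : trivIset setT (fun i => V @^-1` F i).
    by move=> i j _ _ [w [Fi Fj]]; apply: (tF i j) => //; exists (V w).
  have mVF i : measurable (V @^-1` F i) by exact: mVA.
  rewrite (measure_bigcup P setT (fun i => V @^-1` F i `&` E)); last 2 first.
  - by move=> i _; exact: measurableI.
  - exact: trivIset_setIr.
  rewrite measure_bigcup//.
  rewrite (eq_eseriesr (fun i _ => IH i)) muleC.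
  have fE : P E \is a fin_num by exact: fin_num_measure.
  rewrite -(fineK fE) -nneseriesZl//.
  by apply: eq_eseriesr => i _; rewrite muleC.
Qed.

Section Boxes.
Context {R : realType} {n : nat}.

(** The pi-system on which mutual independence of the coordinates is directly expressed. *)
Definition boxes : set (set (n.-tuple R)) :=
  [set A | exists2 B : 'I_n -> set R, forall i, measurable (B i) &
     A = \bigcap_(i in [set: 'I_n]) (fun t => tnth t i) @^-1` B i].

Lemma boxes_generate : @measurable _ (n.-tuple R) = <<s boxes >>.
Proof.
apply/seteqP; split.
  apply: smallest_sub; first exact: smallest_sigma_algebra.
  rewrite -bigcup_seq => A [i _ [B mB <-]]; apply: sub_gen_smallest.
  exists (fun j => if j == i then B else setT) => [j|]; first by case: ifP.
  apply/seteqP; split=> [t [_ Bt] j _ /=|t Bt].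
    by case: eqP => // ->.
  by split=> //; have := Bt i Logic.I; rewrite /= eqxx.
apply: smallest_sub; first exact: sigma_algebra_measurable.
move=> A [B mB ->]; apply: fin_bigcap_measurable => // i _.
by rewrite -[X in measurable X]setTI; exact: measurable_tnth.
Qed.

Lemma boxes_setI : setI_closed boxes.
Proof.
move=> _ _ [B1 mB1 ->] [B2 mB2 ->]; exists (fun i => B1 i `&` B2 i) => [i|].
  exact: measurableI.
apply/seteqP; split=> [t [t1 t2] i _|t Bt]; first by split; [exact: t1|exact: t2].
by split=> i _; have [] := Bt i Logic.I.
Qed.

End Boxes.

Lemma measurable_tupleU {R : realType} {d : measure_display} {T : measurableType d}
    {n : nat} (U : 'I_n -> T -> R) : (forall i, measurable_fun setT (U i)) ->
  measurable_fun setT (fun w => [tuple U i w | i < n]).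
Proof.
move=> mU; apply/measurable_fun_tnthP => i.
by apply: eq_measurable_fun (mU i) => w _ /=; rewrite tnth_mktuple.
Qed.

(** The partner [W] is left general because it is used both with the last coordinate, in the
    induction for the norm moments, and with the pair of noise seeds. *)
Lemma tuple_indep {R : realType} {d dY : measure_display} {T : measurableType d}
    {Y : measurableType dY} (P : probability T R) {n : nat}
    (U : 'I_n -> T -> R) (W : T -> Y) :
  (forall i, measurable_fun setT (U i)) -> measurable_fun setT W ->
  (forall (B : 'I_n -> set R) C, (forall i, measurable (B i)) -> measurable C ->
    P (\bigcap_(i in [set: 'I_n]) (U i @^-1` B i) `&` W @^-1` C) =
    (P (\bigcap_(i in [set: 'I_n]) (U i @^-1` B i)) * P (W @^-1` C))%E) ->
  forall A C, measurable A -> measurable C ->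
  P ((fun w => [tuple U i w | i < n]) @^-1` A `&` W @^-1` C) =
  (P ((fun w => [tuple U i w | i < n]) @^-1` A) * P (W @^-1` C))%E.
Proof.
move=> mU mW box A C mA mC.
apply: (indep_generated P boxes) => //.
- exact: boxes_generate.
- exact: boxes_setI.
- exact: measurable_tupleU.
- by rewrite -[X in measurable X]setTI; exact: mW.
- move=> _ [B mB ->]; rewrite preimage_bigcap.
  have -> : \bigcap_(i in [set: 'I_n]) ((fun w => [tuple U i w | i < n]) @^-1`
      ((fun t => tnth t i) @^-1` B i)) = \bigcap_(i in [set: 'I_n]) (U i @^-1` B i).
    by apply: eq_bigcapr => i _; apply/seteqP; split=> w /=; rewrite tnth_mktuple.
  exact: box.
Qed.

(** * Gaussian moments *)

Section NormalMoments.
Context {R : realType}.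
Local Notation mu := (@lebesgue_measure R).
Local Notation phi := (@normal_pdf R 0 1).

Lemma normal_pdf01E x : phi x = normal_peak 1 * expR (- (x ^+ 2 / 2)).
Proof.
rewrite normal_pdfE ?oner_neq0// /normal_fun subr0 expr1n mulNr.
by rewrite -[X in _ / X]/(2%:R).
Qed.

(** The identity [phi' = - x * phi] is the source of the moment recursion. *)
Lemma is_derive_normal_pdf01 (x : R) : is_derive x 1 phi (- x * phi x).
Proof.
have -> : phi = normal_peak 1 \*: (expR \o ((- 2^-1) \*: (id ^+ 2 : R -> R))).
  apply/funext => y; rewrite normal_pdf01E /= !fctE /GRing.scale/=.
  by rewrite mulNr [y ^+ 2 / 2]mulrC.
have D2 : is_derive x 1 (id ^+ 2 : R -> R) ((2%:R * x ^+ 1) *: (1 : R)).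
  exact: is_deriveX.
have D3 := is_deriveZ (- 2^-1) D2.
have D4 := is_derive1_comp (is_derive_expR _) D3.
have := is_deriveZ (normal_peak 1) D4.
move=> /is_derive_eq; apply; rewrite /= /GRing.scale/= expr1.
by move: (expR _) (normal_peak _) => a b; field.
Qed.

Let q k (x : R) := x ^+ (2 * k) * phi x.

Let q_ge0 k x : 0 <= q k x.
Proof. by rewrite mulr_ge0 ?normal_pdf_ge0// exprM exprn_ge0 ?sqr_ge0. Qed.

Let cq k : continuous (q k).
Proof.
move=> x; apply: cvgM; first exact: exprn_continuous.
by apply: continuous_normal_pdf; rewrite oner_neq0.
Qed.

Let mq k : measurable_fun setT (EFin \o q k).
Proof. by apply/measurable_EFinP; exact: continuous_measurable_fun. Qed.

(* The boundary term of the integration by parts is nonpositive, so only an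
   inequality between moments is needed and no decay estimate is used. *)
Lemma normal_moment_step_itv k (a : R) : 0 < a ->
  (\int[mu]_(x in `[(- a)%R, a]) (q k.+1 x)%:E <=
   (2 * k + 1)%:R%:E * \int[mu]_x (q k x)%:E)%E.
Proof.
move=> a0; have aa : - a < a by rewrite gtrN.
(* [F] is the boundary function of the integration by parts: its derivative is the difference of the
   two moment integrands. *)
pose F x := - (x ^+ (2 * k + 1) * phi x).
pose f x := q k.+1 x - (2 * k + 1)%:R * q k x.
have dF (x : R) : is_derive x 1 F (f x).
  have D1 : is_derive x 1 (id ^+ (2 * k + 1) : R -> R)
      (((2 * k + 1)%:R * x ^+ (2 * k + 1).-1) *: (1 : R)) by exact: is_deriveX.
  have -> : F = - ((id ^+ (2 * k + 1) : R -> R) * phi).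
    by apply/funext => y; rewrite /F !fctE.
  have := is_deriveN (is_deriveM D1 (is_derive_normal_pdf01 x)).
  move=> /is_derive_eq; apply.
  rewrite /f /q /GRing.scale/= addn1/= mulnS fctE exprS !exprD mulr1.
  by move: (phi x) (x ^+ (2 * k)) (2 * k).+1%:R => p y m; ring.
have cf : continuous f.
  by move=> x; apply: cvgB; [exact: cq|apply: cvgM; [exact: cvg_cst|exact: cq]].
have cF : continuous F.
  move=> x; apply: differentiable_continuous; have [dx _] := dF x.
  exact/derivable1_diffP.
have FTC : (\int[mu]_(x in `[(- a)%R, a]) (f x)%:E = (F a)%:E - (F (- a))%:E)%E.
  apply: continuous_FTC2 => //.
  - exact: continuous_subspaceT.
  - split.
    + by move=> x _; have [] := dF x.
    + exact/cvg_at_right_filter/cF.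
    + exact/cvg_at_left_filter/cF.
  - by move=> x _; rewrite derive1E; have [] := dF x.
have FTC0 : (\int[mu]_(x in `[(- a)%R, a]) (f x)%:E <= 0)%E.
  rewrite FTC -EFinB lee_fin /F.
  have -> : phi (- a) = phi a by rewrite !normal_pdf01E sqrrN.
  rewrite addn1 !exprS (exprM (- a)) sqrrN -exprM opprK.
  have : 0 <= a * a ^+ (2 * k) * phi a.
    by rewrite !mulr_ge0 ?normal_pdf_ge0 ?exprn_ge0// ltW.
  by rewrite mulNr; lra.
have intc g : continuous g -> mu.-integrable `[(- a)%R, a] (EFin \o g).
  move=> cg; apply: continuous_compact_integrable; first exact: segment_compact.
  exact: continuous_subspaceT.
have cm : continuous (fun x => (2 * k + 1)%:R * q k x).
  by move=> x; apply: cvgM; [exact: cvg_cst|exact: cq].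
have -> : (\int[mu]_(x in `[(- a)%R, a]) (q k.+1 x)%:E =
    \int[mu]_(x in `[(- a)%R, a]) ((f x)%:E + ((2 * k + 1)%:R * q k x)%:E))%E.
  by apply: eq_integral => x _; rewrite -EFinD subrK.
rewrite integralD//; [|exact: intc|exact: (intc _ cm)].
apply: (@le_trans _ _ (0 + \int[mu]_(x in `[(- a)%R, a]) ((2 * k + 1)%:R * q k x)%:E)%E).
  exact: leeD2r.
rewrite add0e.
under eq_integral do rewrite EFinM.
rewrite ge0_integralZl//; last 2 first.
  by apply: measurable_funTS; exact: mq.
  by move=> x _; rewrite lee_fin.
apply: lee_wpmul2l; first by rewrite lee_fin.
apply: ge0_subset_integral => //; first exact: mq.
by move=> x _; rewrite lee_fin.
Qed.

(** The bound on [[-a, a]] does not depend on [a], so it passes to the limit by monotone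
    convergence. *)
Lemma normal_moment_step k :
  (\int[mu]_x (x ^+ (2 * k.+1) * phi x)%:E <=
   (2 * k + 1)%:R%:E * \int[mu]_x (x ^+ (2 * k) * phi x)%:E)%E.
Proof.
(* The successor keeps every radius positive, as the interval estimate requires. *)
pose A (i : nat) := `[(- i.+1%:R : R), i.+1%:R]%classic.
have AT : \bigcup_i A i = setT.
  apply/seteqP; split=> // x _; exists (Num.truncn `|x|) => //.
  rewrite /A /= in_itv/= -ler_norml ltW//.
  by rewrite truncnS_gt.
have : (\int[mu]_(x in A i) (q k.+1 x)%:E @[i --> \oo] -->
    \int[mu]_(x in \bigcup_i A i) (q k.+1 x)%:E)%E.
  apply: ge0_nondecreasing_set_cvg_integral => //.
  - move=> i j ij; apply/subsetPset => x; rewrite /A /= !in_itv/= -!ler_norml.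
    by move=> /le_trans; apply; rewrite ler_nat ltnS.
  - by move=> i; exact: measurable_itv.
  - by move=> i; apply: measurable_funTS; exact: mq.
  - by move=> i x _; rewrite lee_fin.
rewrite AT => qcvg; rewrite -(cvg_lim _ qcvg)//.
apply: lime_le; first by apply/cvg_ex; eexists; exact: qcvg.
by near=> i; exact: normal_moment_step_itv.
Unshelve. all: by end_near. Qed.

(** Change of variables produces the abstract Radon-Nikodym derivative, which equals [phi] almost
    everywhere because both have the same integral over every measurable set. *)
Lemma ge0_integral_normal_prob (f : R -> \bar R) :
  measurable_fun setT f -> (forall x, 0 <= f x)%E ->
  (\int[normal_prob 0 1]_x f x = \int[mu]_x (f x * (phi x)%:E))%E.
Proof.
move=> mf f0; have dom := normal_prob_dominates 0 (1 : R).
rewrite -(Radon_Nikodym_SigmaFinite.change_of_variables dom)//.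
have mphi : measurable_fun setT (fun x => (phi x)%:E).
  by apply/measurable_EFinP; exact: measurable_normal_pdf.
have iRN := Radon_Nikodym_SigmaFinite.f_integrable dom.
have mRN := measurable_int _ iRN.
apply: ae_eq_integral => //.
- exact: emeasurable_funM.
- exact: emeasurable_funM.
- apply: ae_eqe_mul2l; apply: integral_ae_eq => // E _ mE.
  by rewrite -(Radon_Nikodym_SigmaFinite.f_integral dom).
Qed.

(** The bounds are [1], [3 * 1] and [5 * 3]: the recursion factors are [1, 3, 5], starting from
    total mass one. *)
Lemma normal_moments (d : measure_display) (T : measurableType d)
   (P : probability T R) (y : T -> R) : measurable_fun setT y ->
  (forall B : set R, measurable B -> P (y @^-1` B) = normal_prob 0 1 B) ->
  [/\ \int[P]_w (y w ^+ 2)%:E <= 1,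
     \int[P]_w (y w ^+ 4)%:E <= 3%:E &
     \int[P]_w (y w ^+ 6)%:E <= 15%:E]%E.
Proof.
move=> my Py.
pose M k := (\int[mu]_x (x ^+ (2 * k) * phi x)%:E)%E.
have yM k : (\int[P]_w (y w ^+ (2 * k))%:E = M k)%E.
  have my' : @measurable_fun _ _ T (measurableTypeR R) setT y by exact: my.
  pose ry : {RV P >-> measurableTypeR R} :=
    HB.pack y (isMeasurableFun.Build _ _ _ _ _ my').
  have mx : measurable_fun setT (fun x : R => (x ^+ (2 * k))%:E).
    by apply/measurable_EFinP; exact: measurable_funX.
  have x0 (x : R) : (0 <= (x ^+ (2 * k))%:E)%E by rewrite lee_fin exprM exprn_ge0 ?sqr_ge0.
  rewrite -[LHS](@ge0_integral_distribution _ _ _ _ _ _ ry (fun x => (x ^+ (2 * k))%:E))//.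
  rewrite /M -(ge0_integral_normal_prob (fun x => (x ^+ (2 * k))%:E))//.
  by apply: eq_measure_integral => B mB _; exact: Py.
have M0 : M 0 = 1%E.
  rewrite /M -[RHS](@integral_normal_pdf R 0 1); apply: eq_integral => x _.
  by rewrite muln0 expr0 mul1r.
have M1 : (M 1%N <= 1)%E.
  by have := normal_moment_step 0; rewrite -/(M 0) -/(M 1) M0 mule1.
have M2 : (M 2%N <= 3%:E)%E.
  apply: le_trans (normal_moment_step 1) _; rewrite -/(M 1).
  by apply: (le_trans (lee_wpmul2l _ M1)); rewrite ?mule1 ?lee_fin.
have M3 : (M 3%N <= 15%:E)%E.
  apply: le_trans (normal_moment_step 2) _; rewrite -/(M 2).
  apply: (le_trans (lee_wpmul2l _ M2)); first by rewrite lee_fin.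
  by rewrite -EFinM lee_fin -natrM.
by split; [rewrite (yM 1)|rewrite (yM 2)|rewrite (yM 3)].
Qed.
End NormalMoments.

(** * Moments of a sum of independent squares *)

Section SqNorm.
Context {R : realType} {d : measure_display} {T : measurableType d}
  (P : probability T R).

Definition indep_coords {n} (U : 'I_n -> T -> R) := forall B : 'I_n -> set R,
  (forall i, measurable (B i)) ->
  P (\bigcap_(i in [set: 'I_n]) (U i @^-1` B i)) = (\prod_(i < n) P (U i @^-1` B i))%E.

Lemma bigcap_ord_recr {n} (F : 'I_n.+1 -> set T) :
  \bigcap_(i in [set: 'I_n.+1]) F i =
  \bigcap_(i in [set: 'I_n]) F (widen_ord (leqnSn n) i) `&` F ord_max.
Proof.
apply/seteqP; split=> [w Fw|w [Fw Fm] i _]; first by split=> [i _|]; exact: Fw.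
case: (unliftP ord_max i) => [j ->|-> //].
have -> : lift ord_max j = widen_ord (leqnSn n) j by apply/val_inj; exact: lift_max.
exact: Fw.
Qed.

(** Splits off the last coordinate, in the form that [tuple_indep] expects. *)
Lemma indep_coords_recr {n} (U : 'I_n.+1 -> T -> R) :
  indep_coords U ->
  let U' i := U (widen_ord (leqnSn n) i) in
  indep_coords U' /\
  forall (B : 'I_n -> set R) C, (forall i, measurable (B i)) -> measurable C ->
    P (\bigcap_(i in [set: 'I_n]) (U' i @^-1` B i) `&` U ord_max @^-1` C) =
    (P (\bigcap_(i in [set: 'I_n]) (U' i @^-1` B i)) * P (U ord_max @^-1` C))%E.
Proof.
move=> iU U'.
(* A box in the first [n] coordinates is completed by the side [C]; the choice [C = setT] then gives
   independence of the shorter family. *)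
pose ext (B : 'I_n -> set R) C i := if unlift ord_max i is Some j then B j else C.
have extw B C j : ext B C (widen_ord (leqnSn n) j) = B j.
  have -> : widen_ord (leqnSn n) j = lift ord_max j by apply/val_inj/esym; exact: lift_max.
  by rewrite /ext liftK.
have extm B C : ext B C ord_max = C by rewrite /ext unlift_none.
have key B C : (forall i, measurable (B i)) -> measurable C ->
    P (\bigcap_(i in [set: 'I_n]) (U' i @^-1` B i) `&` U ord_max @^-1` C) =
    (\prod_(i < n) P (U' i @^-1` B i) * P (U ord_max @^-1` C))%E.
  move=> mB mC; have mE i : measurable (ext B C i).
    by rewrite /ext; case: unlift.
  have := iU _ mE; rewrite bigcap_ord_recr big_ord_recr/= extm.
  under eq_bigcapr do rewrite extw.
  by under eq_bigr do rewrite extw.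
have iU' : indep_coords U'.
  move=> B mB; have := key B setT mB measurableT.
  by rewrite preimage_setT setIT probability_setT mule1.
by split=> // B C mB mC; rewrite key// iU'.
Qed.

(** Carrying measurability and nonnegativity along with the bound lets the terms of a binomial
    expansion be added and scaled without integrability. *)
Let bounded_mean (f : T -> R) (p : R) := [/\ measurable_fun setT f,
  forall w, 0 <= f w & (\int[P]_w (f w)%:E <= p%:E)%E].

Let bounded_meanD f g p q : bounded_mean f p -> bounded_mean g q ->
  bounded_mean (fun w => f w + g w) (p + q).
Proof.
move=> [mf f0 fp] [mg g0 gq]; split.
- exact: measurable_funD.
- by move=> w; rewrite addr_ge0.
- under eq_integral do rewrite EFinD.
  rewrite ge0_integralD//; [rewrite EFinD; exact: leeD| | | |].
  + by move=> w _; exact: f0.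
  + exact/measurable_EFinP.
  + by move=> w _; exact: g0.
  + exact/measurable_EFinP.
Qed.

Let bounded_meanZ c f p : 0 <= c -> bounded_mean f p ->
  bounded_mean (fun w => c * f w) (c * p).
Proof.
move=> c0 [mf f0 fp]; split.
- exact: measurable_funM.
- by move=> w; rewrite mulr_ge0.
- under eq_integral do rewrite EFinM.
  rewrite ge0_integralZl ?lee_fin//; first by rewrite EFinM; exact: lee_wpmul2l.
  + exact/measurable_EFinP.
  + by move=> w _; exact: f0.
Qed.

(** Induction on [n] with [S = S' + y ^+ 2]: expand the power and factor each mixed mean by
    independence. The cube involves the lower powers of [S'], so the three bounds must be proved
    together. For the cube, [n(n+2)(n+4) + 3n(n+2) + 9n + 15 = (n+1)(n+3)(n+5)]. *)
Lemma sqnorm_moments n (U : 'I_n -> T -> R) :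
  (forall i, measurable_fun setT (U i)) -> indep_coords U ->
  (forall i, [/\ \int[P]_w (U i w ^+ 2)%:E <= 1,
     \int[P]_w (U i w ^+ 4)%:E <= 3%:E &
     \int[P]_w (U i w ^+ 6)%:E <= 15%:E]%E) ->
  let S w := \sum_(i < n) U i w ^+ 2 in
  [/\ \int[P]_w (S w)%:E <= n%:R%:E,
      \int[P]_w (S w ^+ 2)%:E <= (n%:R * (n%:R + 2))%:E &
      \int[P]_w (S w ^+ 3)%:E <= (n%:R * (n%:R + 2) * (n%:R + 4))%:E]%E.
Proof.
elim: n U => [|n IH] U mU iU Um S.
  have S0 w : S w = 0 by rewrite /S big_ord0.
  by split; rewrite integral0_eq ?mul0r// => w _; rewrite S0 ?expr0n.
have [iU' iW] := indep_coords_recr U iU.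
set U' := (fun i => U (widen_ord (leqnSn n) i)) in iU' iW.
have mU' i : measurable_fun setT (U' i) by exact: mU.
have [] := IH U' mU' iU' (fun i => Um _).
set S' := fun w => \sum_(i < n) U' i w ^+ 2 => /= E1 E2 E3.
pose y := U ord_max; have my : measurable_fun setT y by exact: mU.
have [Y2 Y4 Y6] := Um ord_max.
have SE w : S w = S' w + y w ^+ 2 by rewrite /S big_ord_recr.
pose V w := [tuple U' i w | i < n].
have mV : measurable_fun setT V by exact: measurable_tupleU.
have iVy := tuple_indep P U' y mU' my iW.
pose g (t : n.-tuple R) := \sum_(i < n) tnth t i ^+ 2.
have mg : measurable_fun setT g.
  apply: measurable_sum => i; apply: measurable_funX; exact: measurable_tnth.
have gV w : g (V w) = S' w by apply: eq_bigr => i _; rewrite tnth_mktuple.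
have g0 t : 0 <= g t by apply: sumr_ge0 => i _; exact: sqr_ge0.
have mS' : measurable_fun setT S'.
  by apply: measurable_sum => i; apply: measurable_funX.
have S'0 w : 0 <= S' w by rewrite -gV.
(* The exponents [a = 0] and [b = 0] are allowed, so the pure powers in the expansion need no
   separate treatment. *)
have mono a b (p q : R) : (\int[P]_w (S' w ^+ a)%:E <= p%:E)%E ->
    (\int[P]_w (y w ^+ (2 * b))%:E <= q%:E)%E ->
    bounded_mean (fun w => S' w ^+ a * y w ^+ (2 * b)) (p * q).
  have y0 (x : R) : 0 <= x ^+ (2 * b) by rewrite exprM exprn_ge0 ?sqr_ge0.
  move=> Hp Hq; split.
  - by apply: measurable_funM; exact: measurable_funX.
  - by move=> w; rewrite mulr_ge0// exprn_ge0.
  - have mga : measurable_fun setT (fun t => g t ^+ a) by exact: measurable_funX.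
    have mxb : measurable_fun setT (fun x : R => x ^+ (2 * b)) by exact: measurable_funX.
    have ga0 t : 0 <= g t ^+ a by exact: exprn_ge0.
    have -> : (\int[P]_w (S' w ^+ a * y w ^+ (2 * b))%:E =
        \int[P]_w (g (V w) ^+ a * y w ^+ (2 * b))%:E)%E.
      by apply: eq_integral => w _; rewrite gV.
    rewrite (ge0_integralM_indep P V y mV my iVy _ _ mga mxb ga0 y0).
    have -> : (\int[P]_w (g (V w) ^+ a)%:E = \int[P]_w (S' w ^+ a)%:E)%E.
      by apply: eq_integral => w _; rewrite gV.
    by rewrite EFinM lee_pmul//; apply: integral_ge0 => w _;
      [exact: exprn_ge0|exact: y0].
have I0 : (\int[P]_w (S' w ^+ 0)%:E <= 1%:E)%E.
  by under eq_integral do rewrite expr0; rewrite integral_cst//= probability_setT mule1.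
have Y0 : (\int[P]_w (y w ^+ (2 * 0))%:E <= 1%:E)%E.
  by under eq_integral do rewrite muln0 expr0; rewrite integral_cst//= probability_setT mule1.
have two : (0 : R) <= 2 by [].
have three : (0 : R) <= 3 by [].
split.
- have [_ _] := bounded_meanD _ _ _ _ (mono 1%N 0%N _ _ E1 Y0) (mono 0%N 1%N _ _ I0 Y2).
  under eq_integral do rewrite expr1 muln0 !expr0 mulr1 mul1r muln1 -SE.
  by rewrite !mulr1 -natr1.
- have [_ _] := bounded_meanD _ _ _ _ (bounded_meanD _ _ _ _ (mono 2%N 0%N _ _ E2 Y0)
    (bounded_meanZ _ _ _ two (mono 1%N 1%N _ _ E1 Y2))) (mono 0%N 2%N _ _ I0 Y4).
  rewrite (_ : _ + _ = n.+1%:R * (n.+1%:R + 2)); last by rewrite -natr1; ring.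
  congr (_ <= _)%E; apply: eq_integral => w _; rewrite SE.
  by congr EFin; rewrite /=; ring.
- have [_ _] := bounded_meanD _ _ _ _ (bounded_meanD _ _ _ _
    (bounded_meanD _ _ _ _ (mono 3%N 0%N _ _ E3 Y0)
    (bounded_meanZ _ _ _ three (mono 2%N 1%N _ _ E2 Y2)))
    (bounded_meanZ _ _ _ three (mono 1%N 2%N _ _ E1 Y4))) (mono 0%N 3%N _ _ I0 Y6).
  rewrite (_ : _ + _ = n.+1%:R * (n.+1%:R + 2) * (n.+1%:R + 4)); last by rewrite -natr1; ring.
  congr (_ <= _)%E; apply: eq_integral => w _; rewrite SE.
  by congr EFin; rewrite /=; ring.
Qed.
End SqNorm.

(** * Mean error *)

(** The cross term vanishes by centering. Here [c] stands for everything frozen while one noise is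
    averaged. *)
Lemma integral_sqrD_centered {R : realType} {d : measure_display}
    {T : measurableType d} (P : probability T R) (N : T -> R) (s c : R) :
  P.-integrable setT (fun w => (N w)%:E) ->
  ('E_P[N] = 0)%E -> ('V_P[N] = (s ^+ 2)%:E)%E ->
  (\int[P]_w ((c + N w) ^+ 2)%:E = (c ^+ 2 + s ^+ 2)%:E)%E.
Proof.
move=> iN EN VN.
have N2 : (\int[P]_w (N w ^+ 2)%:E = (s ^+ 2)%:E)%E.
  rewrite -VN /variance covariance.unlock EN expectation.unlock.
  by apply: eq_integral => w _ /=; rewrite !fctE/= subr0 expr2.
have mN : measurable_fun setT N by apply/measurable_EFinP; exact: measurable_int iN.
have iN2 : P.-integrable setT (fun w => (N w ^+ 2)%:E).
  apply/integrableP; split.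
    by apply/measurable_EFinP; exact: measurable_funX.
  under eq_integral do rewrite gee0_abs ?lee_fin ?sqr_ge0//.
  by rewrite N2 ltry.
have EN' : (\int[P]_w (N w)%:E = 0)%E by rewrite -EN expectation.unlock.
have ic : P.-integrable setT (fun w => (c ^+ 2)%:E).
  exact: finite_measure_integrable_cst.
have iNc : P.-integrable setT (fun w => ((2 * c)%:E * (N w)%:E)%E).
  exact: integrableZl.
have -> : (\int[P]_w ((c + N w) ^+ 2)%:E =
    \int[P]_w ((c ^+ 2)%:E + (2 * c)%:E * (N w)%:E + (N w ^+ 2)%:E))%E.
  apply: eq_integral => w _; rewrite -EFinM -!EFinD; congr EFin; ring.
rewrite integralD//; last exact: integrableD.
rewrite integralD// integralZl// EN' mule0 adde0 N2.
by rewrite integral_cst//= probability_setT mule1.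
Qed.

(** With [B = (n + 6) ^ 3], the equation for [m ^+ 4] makes the noise term equal to [L^2 B m^2 / 4],
    which also bounds the smoothness term. The square of their common sum [L^2 B m^2 / 2] is
    [2 L^2 s^2 n B]. *)
Lemma smoothing_error_le {R : realType} (n : nat) (L s m : R) :
  0 < L -> 0 < s -> 0 < m ->
  m ^+ 4 = 8 * s ^+ 2 * n%:R / (L ^+ 2 * (n%:R + 6) ^+ 3) ->
  L ^+ 2 * m ^+ 2 / 4 * (n%:R * (n%:R + 2) * (n%:R + 4)) + 2 * s ^+ 2 / m ^+ 2 * n%:R
  <= Num.sqrt 2 * L * s * Num.sqrt (n%:R * (n%:R + 6) ^+ 3).
Proof.
move=> L0 s0 m0 m4; have nn : (0 : R) <= n%:R by [].
set N := n%:R in nn m4 *; set B := (N + 6) ^+ 3 in m4 *.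
have B0 : 0 < B by rewrite /B exprn_gt0//; lra.
have m20 : 0 < m ^+ 2 by rewrite exprn_gt0.
have LBm : L ^+ 2 * B * m ^+ 4 = 8 * s ^+ 2 * N.
  rewrite m4; field.
  by rewrite !gt_eqF.
have E2 : 2 * s ^+ 2 / m ^+ 2 * N = L ^+ 2 * B * m ^+ 2 / 4.
  apply: (mulIf (lt0r_neq0 m20)).
  have -> : 2 * s ^+ 2 / m ^+ 2 * N * m ^+ 2 = (8 * s ^+ 2 * N) / 4.
    by field; rewrite gt_eqF.
  by rewrite -LBm; field.
rewrite E2.
apply: (@le_trans _ _ (L ^+ 2 * B * m ^+ 2 / 2)).
  have NB : N * (N + 2) * (N + 4) <= B.
    rewrite -subr_ge0 (_ : _ - _ = 12 * N ^+ 2 + 100 * N + 216); last by rewrite /B; ring.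
    by rewrite !addr_ge0 ?mulr_ge0 ?sqr_ge0.
  have Lm : 0 <= L ^+ 2 * m ^+ 2 / 4 by rewrite divr_ge0// mulr_ge0// sqr_ge0.
  by have := ler_wpM2l Lm NB; move: (_ * (N * _ * _)) => a; lra.
have lhs0 : 0 <= L ^+ 2 * B * m ^+ 2 / 2.
  apply: divr_ge0 => //; apply: mulr_ge0; last exact: sqr_ge0.
  by apply: mulr_ge0; [exact: sqr_ge0|exact: ltW].
have NB0 : 0 <= N * B by apply: mulr_ge0 => //; exact: ltW.
have rhs0 : 0 <= Num.sqrt 2 * L * s * Num.sqrt (N * B).
  apply: mulr_ge0; last exact: sqrtr_ge0.
  by rewrite !mulr_ge0 ?sqrtr_ge0 ?(ltW L0) ?(ltW s0).
rewrite -ler_sqr ?nnegrE//.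
have -> : (L ^+ 2 * B * m ^+ 2 / 2) ^+ 2 = L ^+ 2 * B * (L ^+ 2 * B * m ^+ 4) / 4.
  by field.
rewrite LBm [leRHS]exprMn sqr_sqrtr// exprMn exprMn sqr_sqrtr//.
by rewrite le_eqVlt; apply/orP; left; apply/eqP; field.
Qed.

Lemma rv_of_mktuple {R : realType} {n : nat} (v : 'rV[R]_n) :
  rv_of_tuple [tuple v ord0 i | i < n] = v.
Proof. by apply/rowP => i; rewrite mxE tnth_mktuple. Qed.

Section Independence.
Context {R : realType} {d dX : measure_display} {T : measurableType d}
  {X : measurableType dX} (P : probability T R) {n : nat}
  (U : 'I_n -> T -> R) (Xi1 Xi2 : T -> X).
Hypothesis indep : mutually_indep P U Xi1 Xi2.

Lemma mutually_indep_coords : indep_coords P U.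
Proof.
move=> B mB; have := indep B setT setT mB measurableT measurableT.
by rewrite !preimage_setT !setIT probability_setT !mule1.
Qed.

Lemma mutually_indep_noise C1 C2 : measurable C1 -> measurable C2 ->
  P (Xi1 @^-1` C1 `&` Xi2 @^-1` C2) = (P (Xi1 @^-1` C1) * P (Xi2 @^-1` C2))%E.
Proof.
move=> mC1 mC2; have := indep (fun=> setT) C1 C2 (fun=> measurableT) mC1 mC2.
have -> : \bigcap_(i in [set: 'I_n]) (U i @^-1` setT) = setT by apply/seteqP; split.
by rewrite setTI big1 ?mul1e// => i _; rewrite preimage_setT probability_setT.
Qed.

Hypotheses (mU : forall i, measurable_fun setT (U i))
  (mXi1 : measurable_fun setT Xi1) (mXi2 : measurable_fun setT Xi2).

(** Two extensions in succession: [tuple_indep] reduces [A] to a box, then [indep_generated] reduces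
    [C] to a rectangle, where the mutual product rule applies. *)
Lemma mutually_indep_tuple (A : set (n.-tuple R)) (C : set (X * X)) :
  measurable A -> measurable C ->
  P ((fun w => [tuple U i w | i < n]) @^-1` A `&` (fun w => (Xi1 w, Xi2 w)) @^-1` C) =
  (P ((fun w => [tuple U i w | i < n]) @^-1` A) *
   P ((fun w => (Xi1 w, Xi2 w)) @^-1` C))%E.
Proof.
have mXi : measurable_fun setT (fun w => (Xi1 w, Xi2 w)) by exact: measurable_fun_pair.
move: A C; apply: tuple_indep => // B C mB mC.
(* [indep_generated] varies the left event, so the noise event is moved there and the box becomes
   the fixed event. *)
rewrite setIC muleC.
have mbox : measurable (\bigcap_(i in [set: 'I_n]) (U i @^-1` B i)).
  apply: fin_bigcap_measurable => // i _.
  by rewrite -[X in measurable X]setTI; exact: mU.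
apply: (indep_generated P _ _ _ (measurable_prod_measurableType _ _)) => //.
- move=> _ _ [C1 mC1 [C2 mC2 <-]] [D1 mD1 [D2 mD2 <-]].
  exists (C1 `&` D1); first exact: measurableI.
  exists (C2 `&` D2); first exact: measurableI.
  by rewrite setXI.
- move=> _ [C1 mC1 [C2 mC2 <-]].
  rewrite -[_ @^-1` (C1 `*` C2)]/(Xi1 @^-1` C1 `&` Xi2 @^-1` C2).
  rewrite mutually_indep_noise// setIC setIA indep// mutually_indep_coords//.
  by rewrite -muleA muleC.
Qed.
End Independence.

Section MeanError.
Context {R : realType} {d dX : measure_display} {T : measurableType d}
  {X : measurableType dX} (P : probability T R) {n : nat}.
Context (f : 'rV[R]_n -> R) (L sigma m : R) (nu : 'rV[R]_n -> X -> R)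
  (U : T -> 'rV[R]_n) (Xi1 Xi2 : T -> X) (x : 'rV[R]_n).
Hypothesis df : forall y : 'rV[R]_n, differentiable f y.
Hypothesis Lf : forall y z : 'rV[R]_n, enorm (grad f y - grad f z) <= L * enorm (y - z).
Hypothesis mnu : measurable_fun setT (fun p : n.-tuple R * X => nu (rv_of_tuple p.1) p.2).
Hypothesis mU : forall i : 'I_n, measurable_fun setT (fun w => U w ord0 i).
Hypotheses (mXi1 : measurable_fun setT Xi1) (mXi2 : measurable_fun setT Xi2).
Hypothesis nu1 : forall x : 'rV[R]_n,
     P.-integrable setT (fun w => (nu x (Xi1 w))%:E) /\
     ('E_P[fun w => nu x (Xi1 w)] = 0)%E /\
     ('V_P[fun w => nu x (Xi1 w)] = (sigma ^+ 2)%:E)%E.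
Hypothesis nu2 : forall x : 'rV[R]_n,
     P.-integrable setT (fun w => (nu x (Xi2 w))%:E) /\
     ('E_P[fun w => nu x (Xi2 w)] = 0)%E /\
     ('V_P[fun w => nu x (Xi2 w)] = (sigma ^+ 2)%:E)%E.
Hypothesis indep : mutually_indep P (fun i w => U w ord0 i) Xi1 Xi2.
Hypothesis m0 : 0 < m.

Let D (v : 'rV[R]_n) : R := f (x + m *: v) - f x - m * dotv (grad f x) v.

Lemma err_quantityE w : err_quantity f nu U Xi1 Xi2 x m w =
  dotv (U w) (U w) / m ^+ 2 *
    (D (U w) + nu (x + m *: U w) (Xi1 w) - nu x (Xi2 w)) ^+ 2.
Proof.
rewrite /err_quantity -scalerBl sqr_enorm dotvZ /D.
move: (dotv (U w) (U w)) (dotv _ _) (f _) (f x) (nu _ _) (nu x _) => a b c e g h.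
by field; rewrite gt_eqF.
Qed.

Lemma taylor_remainder_sqr (v : 'rV[R]_n) : D v ^+ 2 <= (L * m ^+ 2 / 2 * dotv v v) ^+ 2.
Proof.
have := descent f L x (m *: v) df Lf.
rewrite sqr_enorm dotvZ dotvZr -/(D v).
have -> : L * (m * m * dotv v v) / 2 = L * m ^+ 2 / 2 * dotv v v.
  by move: (dotv v v) => a; field.
move=> DL; rewrite -(real_normK (num_real (D v))) ler_sqr ?nnegrE//.
exact: le_trans DL.
Qed.

(** The formula of [err_quantityE] as a function of the tuple and the noise pair, since the product
    sigma-algebra lives on tuples. *)
Let g (t : n.-tuple R) (ab : X * X) : R :=
  dotv (rv_of_tuple t) (rv_of_tuple t) / m ^+ 2 *
    (D (rv_of_tuple t) + nu (x + m *: rv_of_tuple t) ab.1 - nu x ab.2) ^+ 2.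

Let g_ge0 t ab : 0 <= g t ab.
Proof. by rewrite mulr_ge0 ?sqr_ge0// divr_ge0 ?dotv_ge0 ?sqr_ge0. Qed.

(** [mnu] sees [nu] only through [rv_of_tuple], so the evaluation point [x + m *: u] has to be
    produced as a measurable tuple. *)
Let measurable_shift (t0 : 'rV[R]_n) (a : R) :
  measurable_fun setT (fun t : n.-tuple R => [tuple t0 ord0 i + a * tnth t i | i < n]).
Proof.
apply: measurable_tupleU => i; apply: measurable_funD => //.
by apply: measurable_funM => //; exact: measurable_tnth.
Qed.

Let rv_of_shift (t0 : 'rV[R]_n) (a : R) (t : n.-tuple R) :
  rv_of_tuple [tuple t0 ord0 i + a * tnth t i | i < n] = t0 + a *: rv_of_tuple t.
Proof. by apply/rowP => i; rewrite !mxE tnth_mktuple. Qed.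

Let measurable_dotv (u : n.-tuple R -> 'rV[R]_n) (v : n.-tuple R -> 'rV[R]_n) :
  (forall i, measurable_fun setT (fun t => u t ord0 i)) ->
  (forall i, measurable_fun setT (fun t => v t ord0 i)) ->
  measurable_fun setT (fun t => dotv (u t) (v t)).
Proof. by move=> mu mv; apply: measurable_sum => i; exact: measurable_funM. Qed.

Let measurable_rv i : measurable_fun setT (fun t : n.-tuple R => rv_of_tuple t ord0 i).
Proof.
apply: (eq_measurable_fun (fun t => tnth t i)); last exact: measurable_tnth.
by move=> t _; rewrite mxE.
Qed.

Let measurable_D : measurable_fun setT (fun t : n.-tuple R => D (rv_of_tuple t)).
Proof.
apply: measurable_funB; last first.
  apply: measurable_funM => //; apply: measurable_dotv => // i; exact: measurable_cst.
apply: measurable_funB => //.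
apply: (measurable_continuous_rV f (fun t => x + m *: rv_of_tuple t)).
  by move=> y; apply: differentiable_continuous.
move=> i; apply: (eq_measurable_fun (fun t => x ord0 i + m * tnth t i)).
  by move=> t _; rewrite !mxE.
apply: measurable_funD => //; apply: measurable_funM => //; exact: measurable_tnth.
Qed.

Let measurable_g : measurable_fun setT (fun z : n.-tuple R * (X * X) => (g z.1 z.2)%:E).
Proof.
apply/measurable_EFinP; apply: measurable_funM.
  apply: measurable_funM => //.
  apply: (measurableT_comp
    (f := fun t : n.-tuple R => dotv (rv_of_tuple t) (rv_of_tuple t))) => //.
  exact: measurable_dotv.
apply: measurable_funX; apply: measurable_funB.
  apply: measurable_funD.
    exact: (measurableT_comp measurable_D).
  have := measurableT_comp mnu (measurable_fun_pair
    (measurableT_comp (measurable_shift x m) (@measurable_fst _ _ (n.-tuple R) (X * X)%type))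
    (measurableT_comp (@measurable_fst _ _ X X) (@measurable_snd _ _ (n.-tuple R) (X * X)%type))).
  by apply: eq_measurable_fun => z _ /=; rewrite rv_of_shift.
have := measurableT_comp mnu (measurable_fun_pair
    (measurable_cst [tuple x ord0 i | i < n])
    (measurableT_comp (@measurable_snd _ _ X X) (@measurable_snd _ _ (n.-tuple R) (X * X)%type))).
by apply: eq_measurable_fun => z _ /=; rewrite rv_of_mktuple.
Qed.

(** With [u] frozen at [t], the two seeds are averaged one after the other; each average contributes
    one [sigma ^+ 2]. *)
Let integral_noise t : (\int[P]_w (g t (Xi1 w, Xi2 w))%:E =
  (dotv (rv_of_tuple t) (rv_of_tuple t) / m ^+ 2 *
    (D (rv_of_tuple t) ^+ 2 + 2 * sigma ^+ 2))%:E)%E.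
Proof.
rewrite (ge0_integral_indep P Xi1 Xi2 mXi1 mXi2 (mutually_indep_noise _ _ _ _ indep)
   (fun ab => (g t ab)%:E)); last 2 first.
- exact: (measurableT_comp measurable_g (measurable_fun_pair (measurable_cst t)
    (@measurable_id _ (X * X)%type setT))).
- by move=> ab; rewrite lee_fin.
set K := _ / _; have K0 : 0 <= K by rewrite divr_ge0 ?dotv_ge0 ?sqr_ge0.
set c := D _.
pose N1 w := nu (x + m *: rv_of_tuple t) (Xi1 w).
pose N2 w := nu x (Xi2 w).
have [i1 [E1 V1]] := nu1 (x + m *: rv_of_tuple t).
have [i2 [E2 V2]] := nu2 x.
have mN1 : measurable_fun setT N1 by apply/measurable_EFinP; exact: measurable_int i1.
have mN2 : measurable_fun setT N2 by apply/measurable_EFinP; exact: measurable_int i2.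
have inner w : (\int[P]_w' (g t (Xi1 w, Xi2 w'))%:E =
    K%:E * (((c + N1 w) ^+ 2)%:E + (sigma ^+ 2)%:E))%E.
  have -> : (\int[P]_w' (g t (Xi1 w, Xi2 w'))%:E =
      \int[P]_w' (K%:E * ((- (c + N1 w) + N2 w') ^+ 2)%:E))%E.
    apply: eq_integral => w' _; rewrite -EFinM; congr EFin.
    rewrite /g/= -/K -/c -/(N1 w) -/(N2 w').
    by rewrite -sqrrN opprB addrC.
  rewrite ge0_integralZl//; last 2 first.
  - by apply/measurable_EFinP; apply: measurable_funX; exact: measurable_funD.
  - by move=> w' _; rewrite lee_fin sqr_ge0.
  by rewrite (integral_sqrD_centered _ _ sigma)// sqrrN EFinD.
under eq_integral do rewrite inner.
have mcN : measurable_fun setT (fun w => ((c + N1 w) ^+ 2)%:E).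
  by apply/measurable_EFinP; apply: measurable_funX; exact: measurable_funD.
have cN0 w : (0 <= ((c + N1 w) ^+ 2)%:E)%E by rewrite lee_fin sqr_ge0.
have s20 : (0 <= (sigma ^+ 2)%:E)%E by rewrite lee_fin sqr_ge0.
rewrite ge0_integralZl//; last 2 first.
- exact: emeasurable_funD.
- by move=> w _; rewrite adde_ge0.
rewrite ge0_integralD//.
rewrite (integral_sqrD_centered _ _ sigma)// integral_cst//= probability_setT mule1.
by rewrite -EFinD -EFinM; congr EFin; ring.
Qed.

Hypothesis normalU : forall (i : 'I_n) (B : set R), measurable B ->
     P ((fun w => U w ord0 i) @^-1` B) = normal_prob 0 1 B.

Lemma mean_err_quantity_le : (\int[P]_w (err_quantity f nu U Xi1 Xi2 x m w)%:E <=
  (L ^+ 2 * m ^+ 2 / 4 * (n%:R * (n%:R + 2) * (n%:R + 4)) +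
   2 * sigma ^+ 2 / m ^+ 2 * n%:R)%:E)%E.
Proof.
pose V w := [tuple U w ord0 i | i < n].
have mV : measurable_fun setT V by exact: measurable_tupleU.
have mXi : measurable_fun setT (fun w => (Xi1 w, Xi2 w)) by exact: measurable_fun_pair.
pose S w := dotv (U w) (U w).
have [E1 E3] : (\int[P]_w (S w)%:E <= n%:R%:E)%E /\
    (\int[P]_w (S w ^+ 3)%:E <= (n%:R * (n%:R + 2) * (n%:R + 4))%:E)%E.
  by have [? _ ?] := sqnorm_moments P n (fun i w => U w ord0 i) mU
    (mutually_indep_coords _ _ _ _ indep) (fun i => normal_moments _ _ P _ (mU i) (normalU i)).
have mS : measurable_fun setT S.
  rewrite /S /dotv; apply: measurable_sum => i; exact: measurable_funM.
have S0 w : 0 <= S w by exact: dotv_ge0.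
have -> : (\int[P]_w (err_quantity f nu U Xi1 Xi2 x m w)%:E =
    \int[P]_w (g (V w) (Xi1 w, Xi2 w))%:E)%E.
  by apply: eq_integral => w _; rewrite err_quantityE /g rv_of_mktuple.
rewrite (ge0_integral_indep P V (fun w => (Xi1 w, Xi2 w)) mV mXi
  (mutually_indep_tuple _ _ _ _ indep mU mXi1 mXi2) (fun z => (g z.1 z.2)%:E))//; last first.
  by move=> z; rewrite lee_fin.
under eq_integral do rewrite integral_noise rv_of_mktuple -/(S _).
have a0 : 0 <= L ^+ 2 * m ^+ 2 / 4 by rewrite divr_ge0// mulr_ge0 ?sqr_ge0.
have s20 : 0 <= 2 * sigma ^+ 2 by apply: mulr_ge0 => //; exact: sqr_ge0.
have b0 : 0 <= 2 * sigma ^+ 2 / m ^+ 2 by apply: divr_ge0 => //; exact: sqr_ge0.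
have Sm0 w : 0 <= S w / m ^+ 2 by apply: divr_ge0 => //; exact: sqr_ge0.
(* Inserting the Taylor bound turns [S / m^2 * D^2] into [L^2 m^2 / 4 * S^3], which is where the
   sixth moment of the norm comes from. *)
apply: (@le_trans _ _ (\int[P]_w ((L ^+ 2 * m ^+ 2 / 4)%:E * (S w ^+ 3)%:E +
    (2 * sigma ^+ 2 / m ^+ 2)%:E * (S w)%:E))%E).
  apply: ge0_le_integral => //.
  - by move=> w _; rewrite lee_fin; apply: mulr_ge0 => //; apply: addr_ge0; rewrite ?sqr_ge0.
  - apply/measurable_EFinP; apply: measurable_funM; first exact: measurable_funM.
    apply: measurable_funD => //; apply: measurable_funX.
    have := measurableT_comp measurable_D mV.
    by apply: eq_measurable_fun => w _ /=; rewrite rv_of_mktuple.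
  - apply: emeasurable_funD; apply/measurable_EFinP; apply: measurable_funM => //.
    exact: measurable_funX.
  - move=> w _; rewrite -!EFinM -EFinD lee_fin.
    have Dw := taylor_remainder_sqr (U w); rewrite -/(S w) in Dw.
    apply: (@le_trans _ _ (S w / m ^+ 2 * ((L * m ^+ 2 / 2 * S w) ^+ 2 + 2 * sigma ^+ 2))).
      by apply: ler_wpM2l => //; rewrite lerD2r.
    rewrite le_eqVlt; apply/orP; left; apply/eqP; move: (S w) => a.
    by field; rewrite gt_eqF.
have mS1 : measurable_fun setT (fun w => (S w)%:E) by exact/measurable_EFinP.
have mS3 : measurable_fun setT (fun w => (S w ^+ 3)%:E).
  by apply/measurable_EFinP; exact: measurable_funX.
have S1 w : (0 <= (S w)%:E)%E by rewrite lee_fin.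
have S3 w : (0 <= (S w ^+ 3)%:E)%E by rewrite lee_fin exprn_ge0.
rewrite ge0_integralD//; last 4 first.
- by move=> w _; rewrite mule_ge0.
- exact: measurable_funeM.
- by move=> w _; rewrite mule_ge0.
- exact: measurable_funeM.
rewrite !ge0_integralZl// EFinD.
apply: leeD; rewrite [leRHS]EFinM; exact: lee_wpmul2l.
Qed.
End MeanError.

Theorem theorem1 (R : realType) (n : nat)
  (f : 'rV[R]_n -> R) (L1 : R)
  (d dX : measure_display) (T : measurableType d) (X : measurableType dX)
  (P : probability T R)
  (nu : 'rV[R]_n -> X -> R) (sigma_a : R)
  (U : T -> 'rV[R]_n) (Xi1 Xi2 : T -> X) :
  (* f convex, continuously differentiable, L1-Lipschitz gradient *)
  convex_fun f ->
  (forall x : 'rV[R]_n, differentiable f x) ->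
  continuous (grad f) ->
  0 < L1 ->
  (forall x y : 'rV[R]_n, enorm (grad f x - grad f y) <= L1 * enorm (x - y)) ->
  (* noise: jointly measurable, mean 0, variance sigma_a^2 > 0 *)
  0 < sigma_a ->
  measurable_fun setT (fun p : n.-tuple R * X => nu (rv_of_tuple p.1) p.2) ->
  (* random elements *)
  (forall i : 'I_n, measurable_fun setT (fun w => U w ord0 i)) ->
  measurable_fun setT Xi1 -> measurable_fun setT Xi2 ->
  (* xi1, xi2 identically distributed *)
  (forall C : set X, measurable C -> P (Xi1 @^-1` C) = P (Xi2 @^-1` C)) ->
  (forall x : 'rV[R]_n,
     P.-integrable setT (fun w => (nu x (Xi1 w))%:E) /\
     ('E_P[fun w => nu x (Xi1 w)] = 0)%E /\
     ('V_P[fun w => nu x (Xi1 w)] = (sigma_a ^+ 2)%:E)%E) ->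
  (forall x : 'rV[R]_n,
     P.-integrable setT (fun w => (nu x (Xi2 w))%:E) /\
     ('E_P[fun w => nu x (Xi2 w)] = 0)%E /\
     ('V_P[fun w => nu x (Xi2 w)] = (sigma_a ^+ 2)%:E)%E) ->
  (* u standard Gaussian: i.i.d. N(0,1) coordinates; u, xi1, xi2 independent *)
  (forall (i : 'I_n) (B : set R), measurable B ->
     P ((fun w => U w ord0 i) @^-1` B) = normal_prob 0 1 B) ->
  mutually_indep P (fun i w => U w ord0 i) Xi1 Xi2 ->
  let mu_star :=
    (8 * sigma_a ^+ 2 * n%:R / (L1 ^+ 2 * (n%:R + 6) ^+ 3)) `^ (4%:R^-1) in
  forall x : 'rV[R]_n,
    (\int[P]_w (err_quantity f nu U Xi1 Xi2 x mu_star w)%:E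
       <= (Num.sqrt 2 * L1 * sigma_a * Num.sqrt (n%:R * (n%:R + 6) ^+ 3))%:E)%E.
Proof.
move=> _ df _ L0 Lf s0 mnu mU mXi1 mXi2 _ nu1 nu2 normalU indep mu_star x.
have rhs0 : 0 <= Num.sqrt 2 * L1 * sigma_a * Num.sqrt (n%:R * (n%:R + 6) ^+ 3).
  apply: mulr_ge0; last exact: sqrtr_ge0.
  by rewrite !mulr_ge0 ?sqrtr_ge0 ?(ltW L0) ?(ltW s0).
(* For [n = 0] the base of [mu_star] is zero and positivity of the step fails; but the vectors are
   empty, so the error vanishes identically. *)
have [n0|n0] := posnP n.
  rewrite integral0_eq// => w _; rewrite /err_quantity sqr_enorm /dotv big1// => i _.
  by have := ltn_ord i; rewrite {2}n0.
have q0 : 0 < 8 * sigma_a ^+ 2 * n%:R / (L1 ^+ 2 * (n%:R + 6) ^+ 3).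
  have nn : (0 : R) < n%:R by rewrite ltr0n.
  have n6 : (0 : R) < n%:R + 6 by exact: addr_gt0.
  by rewrite divr_gt0// !mulr_gt0// exprn_gt0.
have m0 : 0 < mu_star by exact: powR_gt0.
have m4 : mu_star ^+ 4 = 8 * sigma_a ^+ 2 * n%:R / (L1 ^+ 2 * (n%:R + 6) ^+ 3).
  rewrite -powR_mulrn; last exact: ltW.
  by rewrite -powRrM mulVf ?powRr1 ?pnatr_eq0// ltW.
apply: le_trans (mean_err_quantity_le P f L1 sigma_a mu_star nu U Xi1 Xi2 x
  df Lf mnu mU mXi1 mXi2 nu1 nu2 indep m0 normalU) _.
by rewrite lee_fin smoothing_error_le.
Qed.
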